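(* Let $x$ be an indeterminate, let $b_{k}=B_{2k+1}\!\left(\frac{x+1}{2}\right)$ for $k\ge 0$, where $B_m(\cdot)$ is the $m$th Bernoulli polynomial, and let $\big(W_{n}(y;x)\big)_{n\geq 0}$ be the sequence of polynomials, $W_n$ being monic of degree $n$ in $y$ with coefficients in $\mathbb{Q}(x)$, that is orthogonal in $y$ with respect to the sequence $(b_k)$, that is, for all $n\ge 1$, $$y^{r}W_{n}(y;x)\Big|_{y^k=b_{k}}=0\qquad (0\leq r\leq n-1).$$ Then $W_{0}(y;x)=1$, $W_{1}(y;x)=y+\sigma_{0}$, and for $n\geq 1$, $$W_{n+1}(y;x)=(y+\sigma_{n})W_{n}(y;x)+\tau_{n}W_{n-1}(y;x),$$ where $$\sigma_{n}=\binom{n+1}{2}-\frac{x^{2}-1}{4}\quad (n\ge 0)\qquad\text{and}\qquad \tau_{n}=\frac{n^{4}(x^{2}-n^{2})}{4(2n+1)(2n-1)}\quad (n\ge 1).$$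
   Context: The Bernoulli polynomials are defined by $\frac{te^{xt}}{e^t-1}=\sum_{n\ge 0}B_n(x)\frac{t^n}{n!}$. For a polynomial $P(y)=\sum_j p_j y^j$ and a sequence $(a_k)_{k\ge0}$, the evaluation $P(y)\big|_{y^k=a_k}$ means $\sum_j p_j a_j$, i.e. one expands in powers of $y$ and replaces each $y^k$ by $a_k$, including $k=0$ (the constant term $p_0$ is replaced by $p_0a_0$). *)

(* Defs.v *)
From HB Require Import structures.
From mathcomp Require Import all_boot all_order all_algebra.
Set Implicit Arguments.
Unset Strict Implicit.
Unset Printing Implicit Defensive.
Import Order.TTheory GRing.Theory Num.Theory.
Local Open Scope ring_scope.

(* A formal power series in t over R is its coefficient sequence nat -> R. *)

Definition fps_mul (R : nzRingType) (f g : nat -> R) (n : nat) : R :=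
  \sum_(i < n.+1) f i * g (n - i)%N.

(* Quotient f / g of power series without constant term, g having an
   invertible coefficient of t: the coefficient of t^(n+1) in q * g = f
   determines q_n from q_0, ..., q_(n-1).  See fps_quoP and fps_quo_unique. *)
Fixpoint fps_quo_seq (R : unitRingType) (f g : nat -> R) (n : nat) : seq R :=
  if n is m.+1 then
    let s := fps_quo_seq f g m in
    rcons s ((f m.+1 - \sum_(i < m) s`_i * g (m.+1 - i)%N) / g 1%N)
  else [::].

Definition fps_quo (R : unitRingType) (f g : nat -> R) (n : nat) : R :=
  (fps_quo_seq f g n.+1)`_n.

Section FpsQuo.
Variables (R : unitRingType) (f g : nat -> R).

Lemma size_fps_quo_seq n : size (fps_quo_seq f g n) = n.
Proof. by elim: n => //= n IHn; rewrite size_rcons IHn. Qed.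

Lemma nth_fps_quo_seq n i : (i < n)%N -> (fps_quo_seq f g n)`_i = fps_quo f g i.
Proof.
elim: n => // n IHn; rewrite ltnS leq_eqVlt => /predU1P[-> // | lt_in].
by rewrite /= nth_rcons size_fps_quo_seq lt_in IHn.
Qed.

Lemma fps_quoE n : fps_quo f g n =
  (f n.+1 - \sum_(i < n) fps_quo f g i * g (n.+1 - i)%N) / g 1%N.
Proof.
rewrite /fps_quo /= nth_rcons size_fps_quo_seq ltnn eqxx.
by congr ((_ - _) / _); apply: eq_bigr => i _; rewrite nth_fps_quo_seq.
Qed.

Hypotheses (f0 : f 0%N = 0) (g0 : g 0%N = 0) (g1 : g 1%N \is a GRing.unit).

Lemma fps_quoP n : fps_mul (fps_quo f g) g n = f n.
Proof.
case: n => [|n]; rewrite /fps_mul.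
  by rewrite big_ord_recr big_ord0 /= g0 mulr0 addr0.
rewrite !big_ord_recr /= subnn g0 mulr0 addr0 subSnn (fps_quoE n).
by rewrite divrK // addrC subrK.
Qed.

Lemma fps_quo_unique q : (forall n, fps_mul q g n = f n) -> q =1 fps_quo f g.
Proof.
move=> qP n; have [m] := ubnP n; elim: m n => // m IHm n; rewrite ltnS => le_nm.
rewrite fps_quoE -(qP n.+1) /fps_mul !big_ord_recr /=.
rewrite subnn g0 mulr0 addr0 subSnn [X in X - _]addrC.
rewrite (eq_bigr (fun i : 'I_n => fps_quo f g i * g (n.+1 - i)%N)) => [|i _].
  by rewrite addrK mulrK.
by rewrite IHm // (leq_trans (ltn_ord i)).
Qed.

End FpsQuo.

(* e^(c t), as a power series in t with coefficients in Q[x] *)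
Definition fps_exp (c : {poly rat}) (n : nat) : {poly rat} :=
  (n`!%:R)^-1 *: c ^+ n.

(* t e^(x t), with x = 'X *)
Definition bernoulli_num : nat -> {poly rat} :=
  fps_mul (fun n => (n == 1%N)%:R) (fps_exp 'X).

(* e^t - 1 *)
Definition bernoulli_den (n : nat) : {poly rat} := fps_exp 1 n - (n == 0%N)%:R.

(* B_n(x) is n! times the coefficient of t^n in t e^(x t) / (e^t - 1). *)
Definition bernoulli (n : nat) : {poly rat} :=
  n`!%:R *: fps_quo bernoulli_num bernoulli_den n.

Lemma bernoulli_gf n :
  fps_mul (fun k => (k`!%:R)^-1 *: bernoulli k) bernoulli_den n
    = bernoulli_num n.
Proof.
have E k : (k`!%:R)^-1 *: bernoulli k = fps_quo bernoulli_num bernoulli_den k.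
  by rewrite scalerA mulVf ?scale1r // pnatr_eq0 -lt0n fact_gt0.
rewrite /fps_mul (eq_bigr (fun i : 'I_n.+1 => fps_quo bernoulli_num bernoulli_den i
  * bernoulli_den (n - i)%N)) => [|i _]; last by rewrite E.
apply: fps_quoP.
- by rewrite /bernoulli_num /fps_mul big_ord_recr big_ord0 /= mul0r addr0.
- by rewrite /bernoulli_den /fps_exp expr0 invr1 scale1r subrr.
- by rewrite /bernoulli_den /fps_exp expr1 invr1 scale1r subr0 unitr1.
Qed.

(* P(y) |_{y^k = a_k}, with y = 'X *)
Definition umbral_eval (K : nzRingType) (P : {poly K}) (a : nat -> K) : K :=
  \sum_(j < size P) P`_j * a j.

Definition monic_orthogonal (K : nzRingType) (a : nat -> K)
    (W : nat -> {poly K}) : Prop :=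
  (forall n, W n \is monic /\ size (W n) = n.+1) /\
  (forall n r : nat, (1 <= n)%N -> (r <= n - 1)%N ->
     umbral_eval ('X^r * W n) a = 0).

Definition Qx : fieldType := {fraction {poly rat}}.

Definition xx : Qx := tofrac 'X.

(* B_{2k+1}((x+1)/2) is formed in Q[x], then embedded in Q(x). *)
Definition b (k : nat) : Qx :=
  tofrac (bernoulli (2 * k + 1) \Po (2^-1 *: ('X + 1))).

Definition sigma (n : nat) : Qx := 'C(n.+1, 2)%:R - (xx ^+ 2 - 1) / 4.

Definition tau (n : nat) : Qx :=
  (n%:R ^+ 4 * (xx ^+ 2 - n%:R ^+ 2)) / (4 * (2 * n%:R + 1) * (2 * n%:R - 1)).

(* Main.v *)
Require Import Defs.
From HB Require Import structures.
From mathcomp Require Import all_boot all_order all_algebra.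
From mathcomp Require Import ring zify.
Set Implicit Arguments.
Unset Strict Implicit.
Unset Printing Implicit Defensive.
Import GRing.Theory Num.Theory.
Local Open Scope ring_scope.

(** Put z = (x + 1) / 2, let E be the linear functional on polynomials in t
    with E(t^m) = B_m(z), and let L be the functional y^k |-> b_k.  Since
    b_k = B_{2k+1}(z), one has L(P) = E(t P(t^2)), and the generating function
    of the Bernoulli polynomials says exactly that
    E(F(t + 1) - F(t)) = F'(z) for every polynomial F.

    This evaluates L in closed form on the Newton basis
    phi_k(y) = prod_{j < k} (y - (z + j)^2) (newton_basis): the polynomial
      F_k(t) = prod_{j <= k} (t - z - j) (t + z - 1 + j)
    satisfies F_k(t + 1) - F_k(t) = 2 (k + 1) t phi_k(t^2), and z is a root of
    its factor j = 0, so that F_k'(z) is a product of values.  Hence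
      L(phi_k) = (-1)^k k! x (x + 1) ... (x + k) / (2 (k + 1))
    (lemma umbral_newton_basis).

    The orthogonal polynomials are the monic Wilson polynomials
    Q_n = sum_k q_{n,k} phi_k whose four parameters are z, z, 1 - z, 1 - z, in
    the variable y = -u^2.  Their coefficients q_{n,k} are hypergeometric, so
    the claimed three-term recurrence reduces to a rational identity for each
    k (wilson_coef_rec), and L(Q_n) = 0 for n > 0 because the sum of the
    q_{n,k} L(phi_k) telescopes (wilson_partial_mean).  Up to a factor,
    q_{n,k} L(phi_k) is the integral over [0, 1] of the term of degree k of
    the shifted Legendre polynomial P_n, and the telescoping is the Legendre
    equation (t (1 - t) P_n')' = - n (n + 1) P_n.

    The rest is the easy half of Favard's theorem: a recurrence
    Q_{n+1} = (y + s_n) Q_n + t_n Q_{n-1} and L(Q_n) = 0 for n > 0 force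
    L(y^r Q_n) = 0 for r < n and L(y^n Q_n) = (-1)^n t_1 ... t_n L(1).  Here
    all t_n and L(1) = x / 2 are nonzero in Q(x), so no other monic
    sequence is orthogonal (orthogonal_uniqueness), and W = Q. *)

(** * Umbral evaluation as a linear functional *)

Section Umbral.
Variables (K : fieldType) (a : nat -> K).

(** The sequence comes before the polynomial, so that the partial application
    can carry a linear structure. *)
Definition umbral (P : {poly K}) : K := umbral_eval P a.

Lemma umbral_widen N (P : {poly K}) :
  (size P <= N)%N -> umbral P = \sum_(j < N) P`_j * a j.
Proof.
move=> le_N; rewrite /umbral /umbral_eval (big_ord_widen N (fun j => P`_j * a j)) //.
rewrite big_mkcond; apply: eq_bigr => j _.
by case: ltnP => // le_j; rewrite nth_default ?mul0r.
Qed.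

Fact umbral_is_linear : scalar umbral.
Proof.
move=> c P R; pose N := maxn (size P) (size R).
have leP : (size (P : {poly K}) <= N)%N by rewrite leq_maxl.
have leR : (size (R : {poly K}) <= N)%N by rewrite leq_maxr.
have leS : (size (c *: P + R : {poly K})%R <= N)%N.
  rewrite (leq_trans (size_polyD _ _)) // geq_max leR andbT.
  exact: leq_trans (size_scale_leq _ _) leP.
rewrite !(@umbral_widen N) // mulr_sumr -big_split /=.
by apply: eq_bigr => j _; rewrite coefD coefZ mulrDl mulrA.
Qed.

HB.instance Definition _ := GRing.isLinear.Build K {poly K} K _ umbral
  umbral_is_linear.

Lemma umbralXn k : umbral 'X^k = a k.
Proof.
rewrite (@umbral_widen k.+1) ?size_polyXn // big_ord_recr /= big1.
  by rewrite add0r coefXn eqxx mul1r.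
by move=> j _; rewrite coefXn ltn_eqF ?mul0r.
Qed.

Lemma umbral1 : umbral 1 = a 0.
Proof. by rewrite -(umbralXn 0) expr0. Qed.

Lemma umbralM (P R : {poly K}) :
  umbral (P * R) = \sum_(r < size P) P`_r * umbral ('X^r * R).
Proof.
rewrite -[X in umbral (X * _)]coefK poly_def mulr_suml linear_sum.
by apply: eq_bigr => r _; rewrite -scalerAl linearZ.
Qed.

Lemma eq_on_monomials (f g : {poly K} -> K) :
  scalar f -> scalar g -> (forall k, f 'X^k = g 'X^k) -> f =1 g.
Proof.
move=> f_lin g_lin fg P.
pose Lf : {linear {poly K} -> K | *%R} :=
  HB.pack f (GRing.isLinear.Build K {poly K} K _ f f_lin).
pose Lg : {linear {poly K} -> K | *%R} :=
  HB.pack g (GRing.isLinear.Build K {poly K} K _ g g_lin).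
rewrite -[f]/(Lf : _ -> _) -[g]/(Lg : _ -> _) -[P]coefK poly_def !linear_sum.
by apply: eq_bigr => i _; rewrite !linearZ /= fg.
Qed.

End Umbral.

(** * Orthogonality from a three-term recurrence *)

Section Orthogonality.
Variables (K : fieldType) (a : nat -> K) (s t : nat -> K) (Q : nat -> {poly K}).
Hypotheses (Q0 : Q 0 = 1) (Q1 : Q 1 = 'X + (s 0)%:P).
Hypothesis Q_rec :
  forall n, Q n.+2 = ('X + (s n.+1)%:P) * Q n.+1 + t n.+1 *: Q n.
Hypothesis Q_mean0 : forall n, umbral a (Q n.+1) = 0.

Lemma three_term_monic n : Q n \is monic /\ size (Q n) = n.+1.
Proof.
elim/ltn_ind: n => -[|[|n]] IHn; first by rewrite Q0 monic1 size_poly1.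
  by rewrite Q1 -[_%:P]opprK -polyCN monicXsubC size_XsubC.
have [[mon1 sz1] [_ sz0]] := (IHn n.+1 (leqnn _), IHn n (leqnSn _)).
have monX : 'X + (s n.+1)%:P \is monic.
  by rewrite -[_%:P]opprK -polyCN monicXsubC.
have szX : size (('X + (s n.+1)%:P) * Q n.+1) = n.+3.
  by rewrite size_monicM ?monic_neq0 // sz1 -[_%:P]opprK -polyCN size_XsubC.
have lt_sz : (size (t n.+1 *: Q n) < size (('X + (s n.+1)%:P) * Q n.+1)%R)%N.
  by rewrite szX (leq_ltn_trans (size_scale_leq _ _)) // sz0.
rewrite Q_rec size_polyDl // szX; split=> //.
by rewrite monicE lead_coefDl // -monicE monicMl.
Qed.

Lemma umbral_XnM_rec r n :
  umbral a ('X^r * Q n.+2) = umbral a ('X^(r.+1) * Q n.+1)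
    + s n.+1 * umbral a ('X^r * Q n.+1) + t n.+1 * umbral a ('X^r * Q n).
Proof.
rewrite Q_rec -[s n.+1 * _]linearZ -[t n.+1 * _]linearZ -!raddfD /=.
by rewrite -!mul_polyC exprS; congr umbral; ring.
Qed.

(** The recurrence expresses multiplication of Q_n by y through Q_{n+1}, Q_n
    and Q_{n-1}, which reduces the power r to r - 1 while the index decreases by
    one at most; the vanishing of the means starts the induction. *)
Lemma three_term_orthogonal r n : (r < n)%N -> umbral a ('X^r * Q n) = 0.
Proof.
elim: r n => [|r IHr] [|[|n]] // lt_rn; rewrite ?expr0 ?mul1r ?Q_mean0 //.
have {}lt_rn : (r < n.+1)%N by [].
have := umbral_XnM_rec r n.+1.
by rewrite !IHr ?(leqW (leqW lt_rn), leqW lt_rn, lt_rn) // !mulr0 !addr0 => <-.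
Qed.

Lemma three_term_norm n : umbral a ('X^n * Q n) = (\prod_(i < n) - t i.+1) * a 0.
Proof.
elim: n => [|n IHn]; first by rewrite big_ord0 expr0 mul1r Q0 umbral1 mul1r.
have := umbral_XnM_rec n n.
rewrite (@three_term_orthogonal n n.+2) ?(@three_term_orthogonal n n.+1) //.
rewrite mulr0 addr0 IHn => /esym/eqP.
by rewrite addr_eq0 => /eqP->; rewrite big_ord_recr /=; ring.
Qed.

Hypotheses (a0_neq0 : a 0 != 0) (t_neq0 : forall n, t n.+1 != 0).

(** If D has degree d < n, pairing it with Q_d gives 0 because D is orthogonal
    to all powers up to d, but also lead_coef D times the norm of Q_d, because
    Q_d is orthogonal to the lower powers in D. *)
Lemma three_term_nondegenerate n (D : {poly K}) : (size D <= n)%N ->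
  (forall r, (r < n)%N -> umbral a ('X^r * D) = 0) -> D = 0.
Proof.
move=> leD orthD; apply/eqP; apply: contraT => nzD.
have: umbral a (D * Q (size D).-1) = umbral a (Q (size D).-1 * D).
  by rewrite mulrC.
rewrite !umbralM (three_term_monic _).2.
rewrite [RHS]big1 => [|r _]; last first.
  by rewrite orthD ?mulr0 // (leq_trans (ltn_ord r)) // prednK ?size_poly_gt0.
rewrite -(@prednK (size D)) ?size_poly_gt0 // big_ord_recr /= big1 => [|r _].
  rewrite add0r three_term_norm => /eqP; rewrite !mulf_eq0 (negPf a0_neq0) orbF.
  rewrite -lead_coefE lead_coef_eq0 (negPf nzD) /=.
  by rewrite prodf_seq_eq0 => /hasP[i _ /=]; rewrite oppr_eq0 (negPf (t_neq0 i)).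
by rewrite three_term_orthogonal ?mulr0.
Qed.

Lemma orthogonal_uniqueness W : monic_orthogonal a W -> W =1 Q.
Proof.
case=> monW orthW n; apply/eqP; rewrite -subr_eq0; apply/eqP.
have [[monWn szW] [monQn szQ]] := (monW n, three_term_monic n).
apply: (@three_term_nondegenerate n) => [|r lt_rn].
  apply/leq_sizeP => j; rewrite leq_eqVlt coefB => /predU1P[<-|lt_nj].
    move: monWn monQn; rewrite !monicE !lead_coefE szW szQ /= => /eqP-> /eqP->.
    exact: subrr.
  by rewrite !nth_default ?subr0 // (szW, szQ).
rewrite mulrBr linearB /= three_term_orthogonal // subr0.
have n_gt0 := leq_ltn_trans (leq0n r) lt_rn.
by apply: orthW; rewrite // -ltnS subn1 prednK.
Qed.

End Orthogonality.

(** * Bernoulli moments of the Newton basis *)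

Section BernoulliMoments.
Variables (K : fieldType) (beta : nat -> K) (z : K).
(** Satisfied by beta m = B_m(z): it is B_m(z + 1) - B_m(z) = m z^(m-1), with
   B_m(z + 1) expanded in the B_i(z). *)
Hypothesis beta_diff :
  forall m, \sum_(i < m) beta i *+ 'C(m, i) = z ^+ m.-1 *+ m.

Local Notation E := (umbral beta).

Lemma umbral_difference (F : {poly K}) :
  E (F \Po ('X + 1) - F) = F^`().[z].
Proof.
move: F; apply: eq_on_monomials => [c P R|c P R|m].
- by rewrite comp_polyD comp_polyZ opprD addrACA -scalerBr linearP.
- by rewrite derivD derivZ hornerD hornerZ.
rewrite comp_Xn_poly addrC exprD1n big_ord_recr /= binn mulr1n addrC addrK.
rewrite linear_sum derivXn hornerMn hornerXn -beta_diff.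
by apply: eq_bigr => i _; rewrite raddfMn /= umbralXn.
Qed.

(** Here y stands for t^2, and the extra factor t makes the exponents odd; this
    is what lets the difference rule apply to the odd moments. *)
Lemma umbral_odd P : umbral (fun k => beta (2 * k + 1)) P = E ('X * (P \Po 'X^2)).
Proof.
move: P; apply: eq_on_monomials => [c P R|c P R|k]; first exact: linearP.
  by rewrite comp_polyD comp_polyZ mulrDr -scalerAr linearP.
by rewrite umbralXn comp_Xn_poly -exprM -exprS umbralXn addn1.
Qed.

Definition newton_basis k : {poly K} := \prod_(j < k) ('X - ((z + j%:R) ^+ 2)%:P).

(** A polynomial in t whose difference F(t + 1) - F(t) is, up to a scalar, t
    times the Newton basis at t^2: shifting t by 1 shifts each of the two
    families of roots, z + j and 1 - z - j, along itself, so that F(t) and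
    F(t + 1) differ only in the factors at the ends. *)
Definition newton_antidiff k : {poly K} :=
  \prod_(j < k.+1) (('X - (z + j%:R)%:P) * ('X + (z - 1 + j%:R)%:P)).

Let newton_basis_sqrS k : newton_basis k.+1 \Po 'X^2 =
  (newton_basis k \Po 'X^2) * ('X^2 - ((z + k%:R) ^+ 2)%:P).
Proof.
by rewrite /newton_basis big_ord_recr /= comp_polyM comp_polyB comp_polyX comp_polyC.
Qed.

Lemma newton_antidiffE k : newton_antidiff k =
  ('X - (z + k%:R)%:P) * ('X + (z - 1)%:P) * (newton_basis k \Po 'X^2).
Proof.
elim: k => [|k IHk].
  by rewrite /newton_antidiff big_ord1 /newton_basis big_ord0 comp_polyC !addr0 mulr1.
rewrite /newton_antidiff big_ord_recr /= -/(newton_antidiff k) IHk.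
rewrite newton_basis_sqrS; ring.
Qed.

Lemma newton_antidiff_shift k : newton_antidiff k \Po ('X + 1) =
  ('X - (z - 1)%:P) * ('X + (z + k%:R)%:P) * (newton_basis k \Po 'X^2).
Proof.
elim: k => [|k IHk].
  rewrite /newton_antidiff big_ord1 /newton_basis big_ord0 comp_polyC mulr1.
  rewrite comp_polyM comp_polyB comp_polyD !comp_polyC !comp_polyX.
  by rewrite !addr0; ring.
rewrite /newton_antidiff big_ord_recr /= -/(newton_antidiff k) comp_polyM IHk.
rewrite newton_basis_sqrS.
rewrite comp_polyM comp_polyB comp_polyD !comp_polyC !comp_polyX.
ring.
Qed.

Lemma newton_antidiff_difference k :
  newton_antidiff k \Po ('X + 1) - newton_antidiff k
    = (2 * k.+1%:R) *: ('X * (newton_basis k \Po 'X^2)).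
Proof.
rewrite newton_antidiff_shift newton_antidiffE -mul_polyC; ring.
Qed.

(** Only the factor 'X - z of the product vanishes at z, so the derivative there
    is the value of the other factors. *)
Lemma newton_antidiff_deriv k :
  (newton_antidiff k)^`().[z]
    = (-1) ^+ k * k`!%:R * \prod_(j < k.+1) (2 * z - 1 + j%:R).
Proof.
have ->: newton_antidiff k = ('X - z%:P) * (\prod_(j < k) ('X - (z + j.+1%:R)%:P) *
   \prod_(j < k.+1) ('X + (z - 1 + j%:R)%:P)).
  by rewrite /newton_antidiff big_split /= big_ord_recl addr0 mulrA.
rewrite derivM derivXsubC mul1r hornerD [X in _ + X]hornerM hornerXsubC.
rewrite subrr mul0r addr0.
rewrite hornerM !horner_prod -/(k.+1); congr (_ * _).
  elim: k => [|k IHk]; first by rewrite big_ord0 mulr1.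
  rewrite big_ord_recr /= IHk hornerXsubC factS natrM exprS; ring.
apply: eq_bigr => j _; rewrite hornerD hornerX hornerC; ring.
Qed.

Lemma umbral_newton_basis k :
  2 * k.+1%:R * umbral (fun k => beta (2 * k + 1)) (newton_basis k) =
    (-1) ^+ k * k`!%:R * \prod_(j < k.+1) (2 * z - 1 + j%:R).
Proof.
rewrite umbral_odd -newton_antidiff_deriv -umbral_difference.
by rewrite newton_antidiff_difference linearZ.
Qed.

End BernoulliMoments.

(** * Wilson polynomials *)

Section WilsonPolynomials.
Variables (K : fieldType) (x : K).
Hypothesis char0 : forall n, n.+1%:R != 0 :> K.
Hypothesis x_neq : forall n, x + n%:R != 0.

Definition rising k : K := \prod_(j < k) (1 + x + j%:R).

(** With z = (x + 1) / 2, the polynomial sum_k wilson_coef n k *: newton_basis z k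
    is the monic multiple of the Wilson series
    4F3(-n, n + 1, z + iu, z - iu; 1, 1, 1 + x; 1) in y = -u^2, where
    (z + iu)_k (z - iu)_k is (-1)^k newton_basis z k at y. *)
Definition wilson_coef n k : K :=
  'C(n, k)%:R * 'C(n + k, k)%:R / 'C(n.*2, n)%:R * (n`!%:R / k`!%:R)
  * (rising n / rising k).

Definition wilson n : {poly K} :=
  \sum_(k < n.+1) wilson_coef n k *: newton_basis ((x + 1) / 2) k.

Definition wilson_s n : K := 'C(n.+1, 2)%:R - (x ^+ 2 - 1) / 4.

Definition wilson_t n : K :=
  (n%:R ^+ 4 * (x ^+ 2 - n%:R ^+ 2)) / (4 * (2 * n%:R + 1) * (2 * n%:R - 1)).

Let natr_neq0 n : (0 < n)%N -> n%:R != 0 :> K.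
Proof. by case: n. Qed.

Let two_neq0 : 2 != 0 :> K. Proof. exact: (char0 1). Qed.

Let four_neq0 : 4 != 0 :> K. Proof. exact: (char0 3). Qed.

Let shift_neq0 n : 1 + x + n%:R != 0.
Proof. by rewrite addrAC addrC nat1r x_neq. Qed.

Lemma risingS k : rising k.+1 = rising k * (1 + x + k%:R).
Proof. by rewrite /rising big_ord_recr. Qed.

Let rising_neq0 k : rising k != 0.
Proof. by apply/prodf_neq0 => j _; apply: shift_neq0. Qed.

Let fact_neq0 n : n`!%:R != 0 :> K.
Proof. by rewrite natr_neq0 ?fact_gt0. Qed.

Let bin_double_neq0 n : 'C(n.*2, n)%:R != 0 :> K.
Proof. by rewrite natr_neq0 // bin_gt0 -addnn leq_addr. Qed.

Lemma wilson_coef_gt n k : (n < k)%N -> wilson_coef n k = 0.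
Proof. by move=> lt_nk; rewrite /wilson_coef bin_small // !mul0r. Qed.

Lemma wilson_coefnn n : wilson_coef n n = 1.
Proof.
by rewrite /wilson_coef binn addnn mul1r !divff // !mulr1.
Qed.

(** Truncated subtraction does no harm: the binomial vanishes when n < k. *)
Let natrB_bin n k : (n - k)%:R * 'C(n, k)%:R = (n%:R - k%:R) * 'C(n, k)%:R :> K.
Proof.
by case: (leqP k n) => [/natrB-> //|/bin_small->]; rewrite !mulr0.
Qed.

Lemma wilson_coef_succ_idx n k :
  k.+1%:R ^+ 3 * (1 + x + k%:R) * wilson_coef n k.+1
    = (n%:R - k%:R) * (n%:R + k.+1%:R) * wilson_coef n k.
Proof.
have k1 := char0 k.
have -> : (n%:R + k.+1%:R)%R = (n + k.+1)%:R :> K by rewrite natrD.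
have binA : 'C(n, k.+1)%:R = (n%:R - k%:R) * 'C(n, k)%:R / k.+1%:R :> K.
  apply: (mulfI k1); rewrite -[LHS]natrM mul_bin_left natrM natrB_bin.
  by rewrite mulrCA divff // mulr1.
have binB : 'C(n + k.+1, k.+1)%:R = (n + k.+1)%:R * 'C(n + k, k)%:R / k.+1%:R :> K.
  apply: (mulfI k1); rewrite -[LHS]natrM -mul_bin_diag addnS natrM.
  by rewrite mulrCA divff // mulr1.
rewrite /wilson_coef binA binB factS natrM risingS.
by field; rewrite ?nat1r ?k1 ?fact_neq0 ?bin_double_neq0 ?rising_neq0 ?shift_neq0.
Qed.

Lemma wilson_coef_succ_deg n k :
  2 * (2 * n%:R + 1) * (n.+1%:R - k%:R) * wilson_coef n.+1 k
    = n.+1%:R ^+ 2 * (n.+1%:R + k%:R) * (1 + x + n%:R) * wilson_coef n k.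
Proof.
have n1 := char0 n.
have binA : (n.+1%:R - k%:R) * 'C(n.+1, k)%:R = n.+1%:R * 'C(n, k)%:R :> K.
  by rewrite -[RHS]natrM mul_bin_down natrM natrB_bin.
have binB : 'C(n.+1 + k, k)%:R = (n.+1%:R + k%:R) * 'C(n + k, k)%:R / n.+1%:R :> K.
  apply: (mulfI n1); rewrite mulrCA divff // mulr1 -natrD -!natrM.
  by rewrite [in RHS]mul_bin_down addSn -addSn addnK.
have n21 : 2 * n%:R + 1 != 0 :> K.
  by rewrite -natrM natr1.
have binD : 'C(n.+1.*2, n.+1)%:R =
    2 * (2 * n%:R + 1) * 'C(n.*2, n)%:R / n.+1%:R :> K.
  apply: (mulfI n1); rewrite mulrCA divff // mulr1 -[LHS]natrM -mul_bin_diag /=.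
  rewrite -natrM natr1 mulrAC -!natrM; congr _%:R.
  apply/eqP; rewrite -(eqn_pmul2l (ltn0Sn n)); apply/eqP.
  have := mul_bin_down n.*2.+1 n; rewrite -addnn -addSn addnK addSn addnn /= => E.
  by rewrite doubleS mulnCA -E; lia.
rewrite /wilson_coef binB binD factS natrM risingS.
transitivity (2 * (2 * n%:R + 1) * ((n.+1%:R - k%:R) * 'C(n.+1, k)%:R) *
   ((n.+1%:R + k%:R) * 'C(n + k, k)%:R / n.+1%:R /
     (2 * (2 * n%:R + 1) * 'C(n.*2, n)%:R / n.+1%:R) *
   (n.+1%:R * n`!%:R / k`!%:R) * (rising n * (1 + x + n%:R) / rising k))).
  ring.
rewrite binA.
by field; rewrite ?nat1r ?n1 ?n21 ?fact_neq0 ?bin_double_neq0 ?rising_neq0 ?shift_neq0.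
Qed.

Let wilson_coef_prev n k := if k is j.+1 then wilson_coef n j else 0.

(** Multiplication by y acts on the Newton basis by
    y phi_k = phi_{k+1} + (z + k)^2 phi_k, with phi_k = newton_basis z k, so
    this is the three-term recurrence read off at phi_k.  Each term is a rational multiple of
    wilson_coef n.+1 k; only k = n + 2, where that coefficient is zero, has to
    be treated apart. *)
Lemma wilson_coef_rec n k : (k <= n.+2)%N ->
  wilson_coef n.+2 k = wilson_coef_prev n.+1 k
    + (((x + 1) / 2 + k%:R) ^+ 2 + wilson_s n.+1) * wilson_coef n.+1 k
    + wilson_t n.+1 * wilson_coef n k.
Proof.
rewrite leq_eqVlt => /predU1P[->|]; last rewrite ltnS => le_kn.
  by rewrite /= !wilson_coefnn !wilson_coef_gt ?mulr0 ?addr0.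
have n1 : 1 + n%:R != 0 :> K by rewrite nat1r.
have nk1 : 2 + n%:R - k%:R != 0 :> K.
  have -> : 2 + n%:R - k%:R = (n.+2 - k)%:R :> K.
    by rewrite natrB ?(leqW le_kn) //; ring.
  by apply: natr_neq0; rewrite subn_gt0.
have nk : 1 + n%:R + k%:R != 0 :> K by rewrite nat1r -natrD char0.
have n21 : 2 * n%:R + 1 != 0 :> K by rewrite -natrM natr1.
have n23 : 2 * (1 + n%:R) + 1 != 0 :> K by rewrite nat1r -natrM natr1.
have xn : 1 + x + n%:R != 0 by apply: shift_neq0.
pose c := wilson_coef n.+1 k.
have next : wilson_coef n.+2 k = n.+2%:R ^+ 2 * (n.+2%:R + k%:R)
    * (1 + x + n.+1%:R) / (2 * (2 * n.+1%:R + 1) * (n.+2%:R - k%:R)) * c.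
  have := wilson_coef_succ_deg n.+1 k; rewrite -/c => E.
  by rewrite mulrAC -E; field; rewrite nk1 n23.
have prev : wilson_coef_prev n.+1 k = k%:R ^+ 3 * (x + k%:R)
    / ((n.+2%:R - k%:R) * (n.+1%:R + k%:R)) * c.
  case: k @c le_kn nk1 nk {next} => [|j] c le_jn nk1 nk /=.
    by rewrite !(expr0n, mul0r).
  have := wilson_coef_succ_idx n.+1 j; rewrite -/c => E.
  have -> : x + j.+1%:R = 1 + x + j%:R by rewrite -natr1; ring.
  rewrite mulrAC E; field.
  by rewrite [1 + j%:R]nat1r nk nk1.
have below : wilson_coef n k = 2 * (2 * n%:R + 1) * (n.+1%:R - k%:R)
    / (n.+1%:R ^+ 2 * (n.+1%:R + k%:R) * (1 + x + n%:R)) * c.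
  rewrite mulrAC wilson_coef_succ_deg; field.
  by rewrite ?nk1 ?nk ?n1 ?xn.
have bin2 : 'C(n.+2, 2)%:R = (n.+1%:R + 1) * n.+1%:R / 2 :> K.
  apply: (mulfI two_neq0); rewrite mulrCA divff // mulr1 natr1 -!natrM.
  by rewrite mul_bin_left bin1 mulnC subn1.
rewrite next prev below /wilson_s /wilson_t bin2 -/c.
field.
have -> : 2 * (1 + n%:R) - 1 = 2 * n%:R + 1 :> K by ring.
by rewrite xn nk n1 n21 n23 four_neq0 two_neq0 nk1.
Qed.

Let z := (x + 1) / 2.

Let two_zB1 : 2 * z - 1 = x.
Proof. by rewrite /z; field. Qed.

Lemma wilson_widen N n : (n < N)%N ->
  wilson n = \sum_(k < N) wilson_coef n k *: newton_basis z k.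
Proof.
move=> lt_nN; rewrite /wilson.
rewrite (big_ord_widen N (fun k => wilson_coef n k *: newton_basis z k)) //.
rewrite big_mkcond.
apply: eq_bigr => k _; case: ltnP => // lt_nk.
by rewrite wilson_coef_gt ?scale0r.
Qed.

Lemma wilson0 : wilson 0 = 1.
Proof. by rewrite /wilson big_ord1 wilson_coefnn scale1r /newton_basis big_ord0. Qed.

Lemma wilson1 : wilson 1 = 'X + (wilson_s 0)%:P.
Proof.
rewrite /wilson big_ord_recr big_ord1 /= wilson_coefnn scale1r.
rewrite /newton_basis big_ord1 big_ord0 /= addr0 -mul_polyC mulr1 addrCA.
rewrite -polyCN -polyCD.
congr ('X + _%:P); rewrite /wilson_s bin_small // /wilson_coef /rising.
rewrite big_ord1 big_ord0 !bin0 -addnn bin1 /= addr0 fact0 (factS 0) fact0.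
by field; rewrite four_neq0 two_neq0 oner_neq0.
Qed.

Lemma newton_basisS k :
  newton_basis z k.+1 = newton_basis z k * ('X - ((z + k%:R) ^+ 2)%:P).
Proof. by rewrite /newton_basis big_ord_recr. Qed.

Lemma wilson_rec n :
  wilson n.+2 =
    ('X + (wilson_s n.+1)%:P) * wilson n.+1 + wilson_t n.+1 *: wilson n.
Proof.
rewrite (@wilson_widen n.+3 n.+2) //.
rewrite (@wilson_widen n.+3 n) ?(leqW (leqnSn n.+1)) //.
have -> : ('X + (wilson_s n.+1)%:P) * wilson n.+1 = \sum_(k < n.+3)
    (wilson_coef_prev n.+1 k + ((z + k%:R) ^+ 2 + wilson_s n.+1)
       * wilson_coef n.+1 k) *: newton_basis z k.
  under eq_bigr do rewrite scalerDl.
  rewrite big_split /= [X in _ = X + _]big_ord_recl.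
  rewrite [X in _ = _ + X]big_ord_recr /= scale0r add0r.
  rewrite wilson_coef_gt // mulr0 scale0r addr0 -big_split /= /wilson mulr_sumr.
  apply: eq_bigr => k _.
  rewrite add0n newton_basisS -!mul_polyC -/z.
  ring.
rewrite scaler_sumr -big_split /=; apply: eq_bigr => k _.
by rewrite scalerA -scalerDl wilson_coef_rec // -ltnS.
Qed.

Variable beta : nat -> K.
Hypothesis beta_diff :
  forall m, \sum_(i < m) beta i *+ 'C(m, i) = z ^+ m.-1 *+ m.

Let L := umbral (fun k => beta (2 * k + 1)).

Lemma umbral_newton_basis_succ k :
  k.+2%:R * L (newton_basis z k.+1)
    = - (k.+1%:R ^+ 2 * (x + k.+1%:R) * L (newton_basis z k)).
Proof.
apply: (mulfI two_neq0); rewrite mulrA umbral_newton_basis // factS natrM exprS.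
rewrite big_ord_recr /= two_zB1.
set p := \prod_(j < k.+1) (x + j%:R).
have E : 2 * k.+1%:R * L (newton_basis z k) = (-1) ^+ k * k`!%:R * p.
  by rewrite umbral_newton_basis // two_zB1.
transitivity (- (k.+1%:R * (x + k.+1%:R) * ((-1) ^+ k * k`!%:R * p))); first ring.
rewrite -E; ring.
Qed.

(** The Legendre equation, integrated term by term: with p_k the coefficients
    of the shifted Legendre polynomial of degree n, the sum of p_k / (k + 1)
    over k < m is - m p_m / (n (n + 1)). *)
Lemma wilson_partial_mean n m :
  n%:R * n.+1%:R * (\sum_(k < m) wilson_coef n k * L (newton_basis z k))
    = - (m%:R * m.+1%:R * (wilson_coef n m * L (newton_basis z m))).
Proof.
elim: m => [|m IHm]; first by rewrite big_ord0 !(mul0r, mulr0) oppr0.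
rewrite big_ord_recr /= mulrDr IHm.
have -> : m.+1%:R * m.+2%:R * (wilson_coef n m.+1 * L (newton_basis z m.+1))
    = - ((n%:R - m%:R) * (n%:R + m.+1%:R) * wilson_coef n m) * L (newton_basis z m).
  rewrite -wilson_coef_succ_idx.
  transitivity (m.+1%:R * wilson_coef n m.+1 * (m.+2%:R * L (newton_basis z m.+1))).
    ring.
  rewrite umbral_newton_basis_succ; ring.
ring.
Qed.

(** The boundary term of the partial sum vanishes past the degree. *)
Lemma wilson_mean0 n : L (wilson n.+1) = 0.
Proof.
have := wilson_partial_mean n.+1 n.+2.
rewrite wilson_coef_gt // mul0r mulr0 oppr0 => /eqP.
rewrite !mulf_eq0 !(negPf (char0 _)) /= => /eqP <-.
rewrite /wilson /L linear_sum /=.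
by apply: eq_bigr => k _; rewrite linearZ.
Qed.

Hypothesis xB_neq : forall n, x - n%:R != 0.

Lemma wilson_t_neq0 n : wilson_t n.+1 != 0.
Proof.
have n21 : 2 * n.+1%:R + 1 != 0 :> K by rewrite -natrM natr1 char0.
have n2B1 : 2 * n.+1%:R - 1 != 0 :> K.
  by rewrite -natrM mulnS addSn -natr1 addrK addSn char0.
have n1 : n.+1%:R ^+ 4 != 0 :> K by rewrite expf_neq0 ?char0.
by rewrite /wilson_t subr_sqr !mulf_neq0 ?invr_neq0 ?mulf_neq0.
Qed.

Lemma odd_moment0_neq0 : beta 1 != 0.
Proof.
have := umbral_newton_basis beta_diff 0.
rewrite /newton_basis big_ord0 umbral1 big_ord1 expr0 !mul1r !mulr1 addr0.
rewrite two_zB1 => E.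
have := x_neq 0; rewrite addr0 -E; apply: contraNN => /eqP ->.
by rewrite !(mulr0, mul0r).
Qed.

Lemma orthogonal_odd_moments_rec W :
  monic_orthogonal (fun k => beta (2 * k + 1)) W ->
  [/\ W 0 = 1, W 1 = 'X + (wilson_s 0)%:P &
    forall n,
      W n.+2 = ('X + (wilson_s n.+1)%:P) * W n.+1 + wilson_t n.+1 *: W n].
Proof.
move=> orthW; have WE : W =1 wilson.
  exact: (orthogonal_uniqueness wilson0 wilson1 wilson_rec wilson_mean0
    odd_moment0_neq0 wilson_t_neq0 orthW).
by split=> [||n]; rewrite !WE ?wilson0 ?wilson1 ?wilson_rec.
Qed.

End WilsonPolynomials.

(** * Bernoulli polynomials at (x + 1) / 2 *)

(** The coefficient of t^m / m! in the identity
    (e^t - 1) sum_i B_i(x) t^i / i! = t e^(x t). *)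
Lemma bernoulli_difference m :
  \sum_(i < m) bernoulli i *+ 'C(m, i) = 'X^(m.-1) *+ m.
Proof.
have := bernoulli_gf m.
rewrite /fps_mul big_ord_recr /= subnn /bernoulli_den /fps_exp /=.
rewrite expr0 fact0 invr1 scale1r subrr mulr0 addr0 => E.
have fact_neq0 n : n`!%:R != 0 :> rat by rewrite pnatr_eq0 -lt0n fact_gt0.
have binE i : (i <= m)%N -> 'C(m, i)%:R = m`!%:R / i`!%:R / (m - i)`!%:R :> rat.
  move=> le_im; rewrite -(bin_fact le_im) !natrM.
  by field; rewrite !fact_neq0.
transitivity (m`!%:R *: bernoulli_num m); last first.
  case: m {E binE} => [|m].
    by rewrite /bernoulli_num /fps_mul big_ord1 mul0r scaler0 mulr0n.
  rewrite /bernoulli_num /fps_mul /fps_exp big_ord_recl mul0r add0r.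
  rewrite big_ord_recl big1 => [|i _]; last by rewrite mul0r.
  rewrite mul1r addr0 /= subSS subn0 scalerA factS natrM.
  by rewrite mulfK ?fact_neq0 // scaler_nat.
rewrite -E scaler_sumr; apply: eq_bigr => i _.
have lt_im := ltn_ord i; rewrite gtn_eqF ?subn_gt0 // subr0 expr1n.
rewrite -scaler_nat (binE i (ltnW lt_im)).
by rewrite -scalerAl -scalerAr mulr1 !scalerA.
Qed.

Lemma char0_Qx n : n.+1%:R != 0 :> Qx.
Proof.
have -> : n.+1%:R = tofrac (n.+1%:R : {poly rat}) by rewrite rmorph_nat.
by rewrite tofrac_eq0 -polyC_natr polyC_eq0 pnatr_eq0.
Qed.

Lemma xx_neq (c : rat) : xx != tofrac c%:P.
Proof.
rewrite /xx tofrac_eq; apply/eqP => /(congr1 (fun p : {poly rat} => size p)).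
by rewrite size_polyX size_polyC; case: eqP.
Qed.

Definition bernoulli_half m : Qx := tofrac (bernoulli m \Po (2^-1 *: ('X + 1))).

Lemma bernoulli_half_difference m :
  \sum_(i < m) bernoulli_half i *+ 'C(m, i) = ((xx + 1) / 2) ^+ m.-1 *+ m.
Proof.
have zE : (xx + 1) / 2 = tofrac (2^-1 *: ('X + 1)).
  apply: (canLR (mulfK (char0_Qx 1))).
  have -> : 2 = tofrac (2 : {poly rat}) :> Qx by rewrite rmorph_nat.
  rewrite /xx -tofrac1 -tofracD -tofracM -scalerAl mulr_natr -scaler_nat scalerA.
  by rewrite mulVf ?scale1r.
rewrite zE -rmorphXn -rmorphMn -comp_Xn_poly -raddfMn -bernoulli_difference.
rewrite !raddf_sum; apply: eq_bigr => i _.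
by rewrite !raddfMn.
Qed.

Theorem theorem4p1 (W : nat -> {poly Qx}) (hW : monic_orthogonal b W) :
  W 0%N = 1 /\
  W 1%N = 'X + (sigma 0)%:P /\
  (forall n : nat, (1 <= n)%N ->
     W n.+1 = ('X + (sigma n)%:P) * W n + tau n *: W n.-1).
Proof.
have xn n : xx + n%:R != 0.
  rewrite addr_eq0; have := xx_neq (- n%:R).
  by rewrite polyCN rmorphN polyC_natr rmorph_nat.
have xsubn n : xx - n%:R != 0.
  by rewrite subr_eq0; have := xx_neq n%:R; rewrite polyC_natr rmorph_nat.
have [W0 W1 W_rec] :=
  orthogonal_odd_moments_rec char0_Qx xn bernoulli_half_difference xsubn hW.
by split; [exact: W0 | split; [exact: W1 | case=> // n _; exact: W_rec]].
Qed.
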